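(* Let $P$ be the distribution of an exchangeable random network such that $\mathrm{sk}(P)$ is the empty graph. Suppose also that one of the following cases holds for nodes $i,j,k,l$ that are all different: \begin{itemize} \item[a)] $ij\perp\!\!\!\perp kl$ and $ij\perp\!\!\!\perp ik$; \item[b)] $ij\perp\!\!\!\perp kl\mid \mathcal D\setminus\{ij,kl\}$ and $ij\perp\!\!\!\perp ik\mid \mathcal D\setminus\{ij,ik\}$. \end{itemize} Then $P$ is faithful to the empty graph if and only if $P$ satisfies the intersection and composition properties.
   Context: Let $\mathcal N$ be a finite set of nodes and $\mathcal D$ the set of dyads, i.e. all two-element subsets of $\mathcal N$; the dyad $\{i,j\}$ is written $ij=ji$. A random network is a family $X=(X_d)_{d\in\mathcal D}$ of $\{0,1\}$-valued random variables with joint distribution $P$. It is exchangeable if for every permutation $\pi$ of $\mathcal N$ and all values $x$, $P\{X_{ij}=x_{ij}\ \forall ij\in\mathcal D\}=P\{X_{ij}=x_{\pi(i)\pi(j)}\ \forall ij\in\mathcal D\}$. For pairwise disjoint $A,B,C\subseteq\mathcal D$, $A\perp\!\!\!\perp B\mid C$ denotes conditional independence of $X_A$ and $X_B$ given $X_C$ under $P$; $A\perp\!\!\!\perp B$ means $A\perp\!\!\!\perp B\mid\varnothing$; single dyads are written without braces. $\mathrm{sk}(P)$ is the undirected graph on $\mathcal D$ in which distinct dyads $u,v$ are non-adjacent iff $u\perp\!\!\!\perp v\mid C$ for some $C\subseteq\mathcal D\setminus\{u,v\}$. The empty graph on $\mathcal D$ has no edges; $P$ is faithful to an undirected graph on $\mathcal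 D$ if for all pairwise disjoint $A,B,C\subseteq\mathcal D$: every path between $A$ and $B$ has a vertex in $C$ iff $A\perp\!\!\!\perp B\mid C$. (For the empty graph, this says that $A\perp\!\!\!\perp B\mid C$ for all pairwise disjoint $A,B,C\subseteq\mathcal D$.) Intersection: for all pairwise disjoint $A,B,C,D\subseteq\mathcal D$, $A\perp\!\!\!\perp B\mid C\cup D$ and $A\perp\!\!\!\perp D\mid C\cup B$ imply $A\perp\!\!\!\perp B\cup D\mid C$. Composition: for all such sets, $A\perp\!\!\!\perp B\mid C$ and $A\perp\!\!\!\perp D\mid C$ imply $A\perp\!\!\!\perp B\cup D\mid C$. *)

(* Defs.v *)
From mathcomp Require Import all_boot all_order all_algebra.
From mathcomp Require Import perm.
From mathcomp Require Import all_classical all_reals all_analysis.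

Set Implicit Arguments.
Unset Strict Implicit.
Unset Printing Implicit Defensive.

Import Order.TTheory GRing.Theory Num.Theory.
Local Open Scope classical_set_scope.
Local Open Scope ring_scope.

Definition dyad (N : finType) : finType := {d : {set N} | #|d| == 2%N}.

Section Dyads.
Variable N : finType.

Lemma dyad_of_subproof (i j : N) : i != j -> #|[set i; j]%SET| == 2%N.
Proof. by move=> ij; rewrite cards2 ij. Qed.

Definition dyad_of (i j : N) (ij : i != j) : dyad N :=
  exist _ [set i; j]%SET (dyad_of_subproof ij).

Lemma perm_dyad_subproof (pi : {perm N}) (d : dyad N) :
  #|(pi @: sval d)%SET| == 2%N.
Proof. by rewrite card_imset ?(svalP d)//; exact: perm_inj. Qed.

Definition perm_dyad (pi : {perm N}) (d : dyad N) : dyad N :=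
  exist _ (pi @: sval d)%SET (perm_dyad_subproof pi d).

End Dyads.

Definition pairwise_disjoint (T : finType) (s : seq {set T}) : bool :=
  pairwise (fun A B : {set T} => (A :&: B)%SET == finset.set0) s.

Section Graphs.
Variable T : finType.

(* An undirected graph on T is given by its adjacency relation. *)
Definition empty_graph : rel T := fun _ _ => false.

Definition separates (e : rel T) (A B C : {set T}) : Prop :=
  forall (x : T) (p : seq T), x \in A -> last x p \in B ->
    path e x p -> uniq (x :: p) -> has (mem C) (x :: p).

End Graphs.

Section RandomNetworks.
Context {d : measure_display} {Omega : measurableType d} {R : realType}.
Context {N : finType}.
Variable P : probability Omega R.

Definition cond_prob (E F : set Omega) : R := fine (P (E `&` F)) / fine (P F).

Variable X : dyad N -> {RV P >-> bool}.

(* The event {X_A = x_A}; the values of x outside A are irrelevant. *)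
Definition net_event (A : {set dyad N}) (x : dyad N -> bool) : set Omega :=
  [set w | forall u, u \in A -> X u w = x u].

Definition exchangeable : Prop :=
  forall (pi : {perm N}) (x : dyad N -> bool),
    P (net_event [set: dyad N]%SET x) =
    P (net_event [set: dyad N]%SET (x \o perm_dyad pi)).

(* Meant for pairwise disjoint A, B, C, so that a single x ranges over all
   triples of values (x_A, x_B, x_C). *)
Definition cond_indep (A B C : {set dyad N}) : Prop :=
  forall x : dyad N -> bool, P (net_event C x) != 0%E ->
    cond_prob (net_event A x `&` net_event B x) (net_event C x) =
    cond_prob (net_event A x) (net_event C x) *
    cond_prob (net_event B x) (net_event C x).

Definition skeleton : rel (dyad N) := fun u v =>
  `[< u <> v /\
      ~ exists C : {set dyad N},
          C \subset (~: [set u; v])%SET /\ cond_indep [set u]%SET [set v]%SET C >].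

Definition faithful (e : rel (dyad N)) : Prop :=
  forall A B C : {set dyad N}, pairwise_disjoint [:: A; B; C] ->
    (separates e A B C <-> cond_indep A B C).

Definition intersection_property : Prop :=
  forall A B C D : {set dyad N}, pairwise_disjoint [:: A; B; C; D] ->
    cond_indep A B (C :|: D)%SET -> cond_indep A D (C :|: B)%SET ->
    cond_indep A (B :|: D)%SET C.

Definition composition_property : Prop :=
  forall A B C D : {set dyad N}, pairwise_disjoint [:: A; B; C; D] ->
    cond_indep A B C -> cond_indep A D C -> cond_indep A (B :|: D)%SET C.

End RandomNetworks.

(* Main.v *)
From mathcomp Require Import all_boot perm action primitive_action alt.
Require Import Defs.
From mathcomp Require Import all_boot all_order all_algebra.
From mathcomp Require Import all_classical all_reals all_analysis.

(** In the empty graph the only paths are single vertices, so disjoint sets are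
    always separated, and faithfulness to the empty graph is the statement that
    [A] and [B] are independent given [C] for all pairwise disjoint [A], [B],
    [C] ([faithful_emptyP]).  This contains the conclusions of intersection and
    composition, which gives one direction.

    For the converse, two distinct dyads either share one node or none, and the
    symmetric group acts transitively on the ordered pairs of either kind
    ([perm_dyad_pair]).  By exchangeability the two assumed independences
    therefore spread to all pairs of distinct dyads ([exchangeable_pairs]).

    In case a) all pairs of dyads are marginally independent.  Composition,
    used on either side, gives independence of [A] and [B :|: C], and weak
    union turns this into independence of [A] and [B] given [C]
    ([mutual_indep_of_pairwise]).

    In case b) every [u] is independent of every [v] given all the other dyads.
    Intersection collects the dyads [v] one at a time until [u] is independent
    of all other dyads together ([intersection_of_points]); restricting to a
    single [v] brings the situation back to case a).

    Conditional independence is handled throughout in the multiplicative form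
    [p(ABC) p(C) = p(AC) p(BC)] of [cond_indepE], which has no division and no
    positivity condition.  In this form decomposition is a sum over the values
    of one discarded dyad ([cond_indep_drop1]). *)

Set Implicit Arguments.
Unset Strict Implicit.
Unset Printing Implicit Defensive.

Import Order.TTheory GRing.Theory Num.Theory.

Lemma disjoint_setUl (T : finType) (A B C : {set T}) :
  [disjoint A :|: B & C]%SET = [disjoint A & C] && [disjoint B & C].
Proof. by rewrite -!finset.setI_eq0 finset.setIUl finset.setU_eq0. Qed.

Lemma disjoint_set0r (T : finType) (A : {set T}) :
  [disjoint A & @finset.set0 T].
Proof. by rewrite -finset.setI_eq0 finset.setI0. Qed.

(** * Permutations of nodes acting on dyads *)

(** The symmetric group on [T] is [#|T|]-transitive, hence transitive on
    repetition-free tuples of any smaller length. *)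
Lemma perm_map_exists (T : finType) (s t : seq T) :
  uniq s -> uniq t -> size s = size t -> exists pi : {perm T}, map pi s = t.
Proof.
move=> s_uniq t_uniq /esym/eqP st.
have s_le : size s <= #|T| by rewrite -(card_uniqP s_uniq) max_card.
have s_dt : in_tuple s \in dtuple_on (size s) [set: T]%SET.
  by rewrite finset.inE /= s_uniq; apply/fintype.subsetP => x; rewrite finset.inE.
have t_dt : Tuple st \in dtuple_on (size s) [set: T]%SET.
  by rewrite finset.inE /= t_uniq; apply/fintype.subsetP => x; rewrite finset.inE.
have [pi _ /(congr1 val) /= ->] :=
  atransP2 (ntransitive_weak s_le (Sym_trans T)) s_dt t_dt.
by exists pi.
Qed.

Section DyadPermutations.
Variable N : finType.
Implicit Types (u v : dyad N) (pi : {perm N}).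

Lemma perm_dyad_inj pi : injective (perm_dyad pi).
Proof.
move=> u v /(congr1 sval) /= uv.
by apply: val_inj; apply: imset_inj uv; exact: perm_inj.
Qed.

Lemma perm_dyadVK pi u : perm_dyad pi (perm_dyad pi^-1 u) = u.
Proof.
apply: val_inj => /=; rewrite -imset_comp -[RHS]finset.imset_id.
by apply: eq_imset => a /=; rewrite permKV.
Qed.

Lemma perm_dyadKV pi u : perm_dyad pi^-1 (perm_dyad pi u) = u.
Proof. by apply: (@perm_dyad_inj pi); rewrite perm_dyadVK. Qed.

Lemma dyad_other_end u (a : N) : a \in sval u ->
  exists2 b, a != b & sval u = [set a; b]%SET.
Proof.
have /cards2P [b [c [bc ->]]] := svalP u.
rewrite finset.in_set2 => /orP[] /eqP ->; first by exists c.
by exists b; rewrite 1?eq_sym// finset.setUC.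
Qed.

(** The relabelling action has only two orbits on ordered pairs of distinct
    dyads: disjoint pairs, represented by [ij, kl], and incident ones,
    represented by [ij, ik].  A disjoint pair prescribes the images of four
    nodes, an incident pair those of three, starting with the shared one. *)
Lemma perm_dyad_pair (i j k l : N) (ij : i != j) (ik : i != k) (kl : k != l)
    u v : uniq [:: i; j; k; l] -> u != v ->
  exists pi, perm_dyad pi u = dyad_of ij /\
    (perm_dyad pi v = dyad_of kl \/ perm_dyad pi v = dyad_of ik).
Proof.
move=> ijkl uv.
have [uv0|[a]] := finset.set_0Vmem (sval u :&: sval v)%SET.
  have /cards2P [a [b [ab ua]]] := svalP u.
  have /cards2P [c [e [ce vc]]] := svalP v.
  have disj z : z \in sval u -> z \notin sval v.
    by move=> zu; apply/negP => zv; have := finset.in_set0 z;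
       rewrite -uv0 finset.inE zu zv.
  have := disj a; have := disj b.
  rewrite ua vc !finset.inE !eqxx orbT /= => /(_ isT) bce /(_ isT) ace.
  have abce : uniq [:: a; b; c; e].
    by rewrite /= !inE !negb_or ab ce -!negb_or ace bce.
  have [pi /= [pia pib pic pie]] := perm_map_exists abce ijkl erefl.
  exists pi; split; last left; apply: val_inj => /=.
    by rewrite ua imsetU1 imset_set1 pia pib.
  by rewrite vc imsetU1 imset_set1 pic pie.
rewrite finset.in_setI => /andP[au av].
have [b ab ub] := dyad_other_end au.
have [c ac vc] := dyad_other_end av.
have bc : b != c.
  by apply: contra uv => /eqP bc; apply/eqP/val_inj; rewrite /= ub vc bc.
have abc : uniq [:: a; b; c] by rewrite /= !inE negb_or ab ac bc.
have ijk : uniq [:: i; j; k] by exact: (take_uniq 3 ijkl).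
have [pi /= [pia pib pic]] := perm_map_exists abc ijk erefl.
exists pi; split; last right; apply: val_inj => /=.
  by rewrite ub imsetU1 imset_set1 pia pib.
by rewrite vc imsetU1 imset_set1 pia pic.
Qed.

End DyadPermutations.

(** * Conditional independence as a product formula *)

Section ConditionalIndependence.
Context {disp : measure_display} {Omega : measurableType disp} {R : realType}.
Context {N : finType} {P : probability Omega R}.
Variable X : dyad N -> {RV P >-> bool}.
Local Open Scope ring_scope.
Implicit Types (A B C D S : {set dyad N}) (x : dyad N -> bool).

Definition net_prob S x : R := fine (P (net_event X S x)).

Lemma net_event_setU A B x :
  net_event X (A :|: B)%SET x = (net_event X A x `&` net_event X B x)%classic.
Proof.
apply/seteqP; split => w /=.
  by move=> AB; split=> u uS; apply: AB; rewrite finset.inE uS ?orbT.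
by move=> [wA wB] u; rewrite finset.inE => /orP[/wA|/wB].
Qed.

Lemma measurable_net_event S x : measurable (net_event X S x).
Proof.
have -> : net_event X S x =
    (\bigcap_(u in [set` S]) (X u @^-1` [set x u]))%classic by [].
apply: fin_bigcap_measurable => [|u _]; first exact: finite_finset.
exact: measurable_funPTI.
Qed.

Lemma net_event_prob_fin_num S x : P (net_event X S x) \is a fin_num.
Proof. exact/fin_num_measure/measurable_net_event. Qed.

Lemma eq_net_prob S x y : {in S, x =1 y} -> net_prob S x = net_prob S y.
Proof.
move=> xy; congr (fine (P _)); apply/seteqP; split => w /= wS u uS.
  by rewrite wS// xy.
by rewrite wS// xy.
Qed.

Lemma le_net_prob S S' x : S \subset S' -> net_prob S' x <= net_prob S x.
Proof.
move=> /fintype.subsetP SS'; apply: fine_le; rewrite ?net_event_prob_fin_num//.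
apply: le_measure; rewrite ?inE; try exact: measurable_net_event.
by move=> w wS' u /SS'; exact: wS'.
Qed.

Lemma net_prob_ge0 S x : 0 <= net_prob S x.
Proof. exact: fine_ge0. Qed.

Lemma net_prob_eq0 S S' x :
  S \subset S' -> net_prob S x = 0 -> net_prob S' x = 0.
Proof.
by move=> SS' S0; apply/eqP; rewrite eq_le net_prob_ge0 -S0 le_net_prob.
Qed.

(** The elementary step of marginalization: one dyad is summed out.  Sums over
    several dyads are replaced by inductions that use this lemma. *)
Lemma net_prob_marginal S u x : u \notin S ->
  net_prob S x = net_prob (u |: S)%SET [eta x with u |-> true]
               + net_prob (u |: S)%SET [eta x with u |-> false].
Proof.
move=> uS; rewrite /net_prob -fineD ?net_event_prob_fin_num//.
have off v : v \in S -> (v == u) = false.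
  by move=> vS; apply: contraNF uS => /eqP <-.
rewrite -measureU; try exact: measurable_net_event; last first.
  apply/seteqP; split => // w [/(_ u) /= + /(_ u) /=].
  by rewrite eqxx finset.setU11 => -> // /(_ isT).
congr (fine (P _)); apply/seteqP; split => w /=.
  move=> wS; case Xu: (X u w); [left|right] => v /=;
    by rewrite finset.in_setU1; case: eqVneq => [->//|_ /=]; exact: wS.
by move=> [] wS v vS; have := wS v; rewrite /= off// finset.in_setU1 vS orbT;
  exact.
Qed.

(** Clearing denominators is harmless where [net_prob C x = 0], since then all
    four factors that contain [C] vanish by monotonicity. *)
Lemma cond_indepE A B C : cond_indep X A B C <->
  forall x, net_prob (A :|: B :|: C)%SET x * net_prob C x =
            net_prob (A :|: C)%SET x * net_prob (B :|: C)%SET x.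
Proof.
have cpE S x : cond_prob P (net_event X S x) (net_event X C x) =
    net_prob (S :|: C)%SET x / net_prob C x.
  by rewrite /cond_prob -net_event_setU.
have PC0 x : (P (net_event X C x) == 0%E) = (net_prob C x == 0).
  by rewrite /net_prob fine_eq0 ?net_event_prob_fin_num.
split=> indep x; last first.
  rewrite PC0 => C0; rewrite -net_event_setU !cpE.
  by rewrite mulf_div -indep -mulf_div divff// mulr1.
have [C0|C0] := eqVneq (net_prob C x) 0.
  by rewrite C0 mulr0 (net_prob_eq0 _ C0) ?mul0r// finset.subsetUr.
have := indep x; rewrite PC0 C0 -net_event_setU !cpE => /(_ isT).
rewrite mulf_div => /(congr1 ( *%R^~ (net_prob C x * net_prob C x))).
by rewrite mulfVK ?mulf_neq0// mulrA mulfVK.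
Qed.

Lemma cond_indepC A B C : cond_indep X A B C -> cond_indep X B A C.
Proof.
move=> /cond_indepE AB; apply/cond_indepE => x.
by rewrite (finset.setUC B A) AB mulrC.
Qed.

Lemma cond_indep_set0 A C : cond_indep X A finset.set0 C.
Proof. by apply/cond_indepE => x; rewrite finset.setU0 finset.set0U. Qed.

(** The product formula for [u |: B] is linear in the two factors that contain
    [u], so summing it over the two values at [u] gives the formula for [B]. *)
Lemma cond_indep_drop1 A B C u : u \notin (A :|: B :|: C)%SET ->
  cond_indep X A (u |: B)%SET C -> cond_indep X A B C.
Proof.
rewrite !finset.in_setU !negb_or => /andP[/andP[uA uB] uC].
move=> /cond_indepE AuB; apply/cond_indepE => x.
(* The factors without [u] take the same value under both choices at [u]. *)
have upd S b : u \notin S -> net_prob S x = net_prob S [eta x with u |-> b].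
  move=> uS; apply: eq_net_prob => v vS /=; case: eqP => // vu.
  by rewrite -vu vS in uS.
have uAC : u \notin (A :|: C)%SET by rewrite finset.in_setU negb_or uA.
have uBC : u \notin (B :|: C)%SET by rewrite finset.in_setU negb_or uB.
have uABC : u \notin (A :|: B :|: C)%SET.
  by rewrite 2!finset.in_setU !negb_or uA uB.
rewrite (net_prob_marginal _ uABC) (net_prob_marginal _ uBC) mulrDl mulrDr.
suff step b : let y := [eta x with u |-> b] in
    net_prob (u |: (A :|: B :|: C))%SET y * net_prob C y =
    net_prob (A :|: C)%SET y * net_prob (u |: (B :|: C))%SET y.
  congr (_ + _).
    by rewrite (upd C true uC) (upd _ true uAC) step.
  by rewrite (upd C false uC) (upd _ false uAC) step.
rewrite /= (finset.setUA _ B) -AuB; congr (net_prob _ _ * _).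
by apply/finset.setP => v; rewrite !finset.inE -!orbA orbCA.
Qed.

Lemma cond_indep_sub A B C D :
  [disjoint B & A] -> [disjoint B & C] -> D \subset B ->
  cond_indep X A B C -> cond_indep X A D C.
Proof.
move=> BA BC; have [n] := ubnP #|(B :\: D)%SET|; elim: n D => // n IH D.
rewrite ltnS => leBD DB AB.
have [BD|[u]] := finset.set_0Vmem (B :\: D)%SET.
  suff <- : B = D by [].
  by apply/eqP; rewrite finset.eqEsubset DB -finset.setD_eq0 BD eqxx.
rewrite finset.in_setD => /andP[uD uB].
apply: (@cond_indep_drop1 _ _ _ u).
  by rewrite 2!finset.in_setU !negb_or uD (disjointFr BA uB) (disjointFr BC uB).
apply: IH => //; last by rewrite finset.subUset finset.sub1set uB.
apply: leq_trans leBD; apply: proper_card.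
rewrite properE; apply/andP; split.
  by apply: finset.setDS; exact: finset.subsetUr.
by apply/fintype.subsetPn; exists u; rewrite !finset.inE ?eqxx// uD.
Qed.

(** Besides the product formula for [B :|: C] given [D], decomposition supplies
    the one for [C] given [D]; multiplying the target by [p(D)] and substituting
    both leaves an identity.  Where [p(D) = 0] everything vanishes. *)
Lemma cond_indep_weak_union A B C D :
  [disjoint B :|: C & A] -> [disjoint B :|: C & D] ->
  cond_indep X A (B :|: C)%SET D -> cond_indep X A B (C :|: D)%SET.
Proof.
move=> BCA BCD AB; apply/cond_indepE => x.
have AC := cond_indep_sub BCA BCD (finset.subsetUr B C) AB.
move/cond_indepE: AB => /(_ x); move/cond_indepE: AC => /(_ x).
rewrite -!finset.setUA => AC AB.
have [D0|D0] := eqVneq (net_prob D x) 0.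
  have z S : D \subset S -> net_prob S x = 0.
    by move=> DS; exact: net_prob_eq0 D0.
  have DCD : D \subset (C :|: D)%SET by exact: finset.subsetUr.
  by rewrite (z (C :|: D)%SET)// (z (B :|: (C :|: D))%SET) ?mulr0//
    (fintype.subset_trans DCD)// finset.subsetUr.
apply: (mulIf D0).
by rewrite mulrAC AB [RHS]mulrAC AC mulrAC.
Qed.

(** * From single dyads to sets of dyads *)

Lemma pairwise_disjoint3 A B C :
  pairwise_disjoint [:: A; B; C] =
  [&& [disjoint A & B], [disjoint A & C] & [disjoint B & C]].
Proof. by rewrite /pairwise_disjoint /= -!finset.setI_eq0 !andbT -!andbA. Qed.

Lemma pairwise_disjoint4 A B C D :
  pairwise_disjoint [:: A; B; C; D] =
  [&& [disjoint A & B], [disjoint A & C], [disjoint A & D],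
      [disjoint B & C], [disjoint B & D] & [disjoint C & D]].
Proof. by rewrite /pairwise_disjoint /= -!finset.setI_eq0 !andbT -!andbA. Qed.

Lemma pairwise_disjoint_D1 A B C b : b \in B ->
  [disjoint A & B] -> [disjoint A & C] -> [disjoint B & C] ->
  pairwise_disjoint [:: A; [set b]; C; B :\ b]%SET.
Proof.
move=> bB AB AC BC.
have sub : (B :\ b)%SET \subset B := finset.subsetDl _ _.
have sub1 : [set b]%SET \subset B by rewrite finset.sub1set.
have bB' : [disjoint [set b]%SET & (B :\ b)%SET].
  by rewrite disjoints1 !finset.inE eqxx.
rewrite pairwise_disjoint4 (disjointWr sub1 AB) AC (disjointWr sub AB).
by rewrite (disjointWl sub1 BC) bB' disjoint_sym (disjointWl sub BC).
Qed.

Lemma composition_of_points A B C : composition_property X ->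
  [disjoint A & B] -> [disjoint A & C] -> [disjoint B & C] ->
  (forall b, b \in B -> cond_indep X A [set b]%SET C) -> cond_indep X A B C.
Proof.
move=> comp; have [n] := ubnP #|B|; elim: n B => // n IH B.
rewrite ltnS => leB AB AC BC pts.
have [->|[b bB]] := finset.set_0Vmem B; first exact: cond_indep_set0.
have sub : (B :\ b)%SET \subset B := finset.subsetDl _ _.
have sub1 : [set b]%SET \subset B by rewrite finset.sub1set.
rewrite -(finset.setD1K bB); apply: comp; last 2 first.
- exact: pts.
- apply: IH => //.
  + by apply: leq_trans leB; rewrite [ltnRHS](cardsD1 b) bB.
  + by rewrite (disjointWr sub).
  + by rewrite (disjointWl sub).
  + by move=> c /(fintype.subsetP sub); exact: pts.
exact: pairwise_disjoint_D1.
Qed.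

(** In the induction step a dyad [b] of [B] moves into the conditioning set:
    [C :|: B :\ c] is the same set for [B, C] as for [B :\ b, b |: C], so the
    hypothesis passes to the smaller set.  The conditioning set [C] must
    therefore vary in the induction. *)
Lemma intersection_of_points A B C : intersection_property X ->
  [disjoint A & B] -> [disjoint A & C] -> [disjoint B & C] ->
  (forall b, b \in B -> cond_indep X A [set b]%SET (C :|: B :\ b)%SET) ->
  cond_indep X A B C.
Proof.
move=> inter; have [n] := ubnP #|B|; elim: n B C => // n IH B C.
rewrite ltnS => leB AB AC BC pts.
have [->|[b bB]] := finset.set_0Vmem B; first exact: cond_indep_set0.
have sub : (B :\ b)%SET \subset B := finset.subsetDl _ _.
have sub1 : [set b]%SET \subset B by rewrite finset.sub1set.
rewrite -(finset.setD1K bB); apply: inter; last 2 first.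
- exact: pts.
- apply: IH.
  + by apply: leq_trans leB; rewrite [ltnRHS](cardsD1 b) bB.
  + exact: disjointWr sub AB.
  + by rewrite disjoint_sym disjoint_setUl !(disjoint_sym _ A) AC
      (disjointWr sub1 AB).
  + by rewrite disjoint_sym disjoint_setUl disjoints1 !finset.inE eqxx
      disjoint_sym (disjointWl sub BC).
  + move=> c cB'; rewrite -finset.setUA.
    suff -> : ([set b] :|: B :\ b :\ c = B :\ c)%SET.
      exact/pts/(fintype.subsetP sub).
    apply/finset.setP => v; rewrite !finset.inE.
    have [->|] := eqVneq v b; last by [].
    by rewrite bB /= andbT; move: cB'; rewrite !finset.inE eq_sym => /andP[].
exact: pairwise_disjoint_D1.
Qed.

(** * Exchangeability *)

(** Exchangeability is an assumption on full configurations only.  It descends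
    to partial ones by summing out the missing dyads one by one, which is an
    induction on the complement of [S].  Preimages appear because the
    configuration [x \o perm_dyad pi] reads at [v] the value of [x] at the image
    of [v]. *)
Lemma exchangeable_net_prob (pi : {perm N}) S x : exchangeable X ->
  net_prob S x = net_prob (perm_dyad pi @^-1: S)%SET (x \o perm_dyad pi).
Proof.
move=> exch; have [n] := ubnP #|(~: S)%SET|; elim: n S x => // n IH S x.
rewrite ltnS => leS.
have [S0|[u]] := finset.set_0Vmem (~: S)%SET.
  have -> : S = [set: dyad N]%SET.
    by rewrite -(finset.setCK S) S0 finset.setC0.
  by rewrite finset.preimsetT /net_prob (exch pi).
rewrite finset.in_setC => uS.
pose u' := perm_dyad pi^-1 u.
have u'E v : (perm_dyad pi v == u) = (v == u').
  by rewrite -[in RHS](inj_eq (@perm_dyad_inj _ pi)) perm_dyadVK.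
have u'S : u' \notin (perm_dyad pi @^-1: S)%SET.
  by rewrite finset.inE perm_dyadVK.
have pre : (perm_dyad pi @^-1: (u |: S) = u' |: perm_dyad pi @^-1: S)%SET.
  by apply/finset.setP => v; rewrite !finset.inE u'E.
rewrite (net_prob_marginal _ uS) (net_prob_marginal _ u'S).
have lt : (#|(~: (u |: S))%SET| < n)%N.
  apply: leq_trans leS; apply: proper_card; rewrite finset.setCU properE.
  rewrite finset.subsetIr; apply/fintype.subsetPn; exists u; rewrite !finset.inE//.
  by rewrite eqxx.
congr (_ + _); rewrite (IH _ _ lt) pre; apply: eq_net_prob => v _ /=;
  by rewrite u'E.
Qed.

Lemma exchangeable_cond_indep (pi : {perm N}) A B C : exchangeable X ->
  cond_indep X A B C ->
  cond_indep X (perm_dyad pi @^-1: A)%SET (perm_dyad pi @^-1: B)%SET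
    (perm_dyad pi @^-1: C)%SET.
Proof.
move=> exch /cond_indepE ABC; apply/cond_indepE => x.
have xE : (x \o perm_dyad pi^-1) \o perm_dyad pi = x.
  by apply/funext => u /=; rewrite perm_dyadKV.
by rewrite -!finset.preimsetU -xE -!exchangeable_net_prob.
Qed.

Lemma preim_perm_dyad1 (pi : {perm N}) (u : dyad N) :
  (perm_dyad pi @^-1: [set perm_dyad pi u] = [set u])%SET.
Proof.
apply/finset.setP => v; rewrite !finset.inE.
by rewrite (inj_eq (@perm_dyad_inj _ pi)).
Qed.

(** [G] produces the conditioning set from the pair.  The applications are
    the constant [set0] and the complement, both of which commute with
    relabelling. *)
Lemma exchangeable_pairs (G : {set dyad N} -> {set dyad N})
    (i j k l : N) (ij : i != j) (ik : i != k) (kl : k != l) :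
  exchangeable X -> uniq [:: i; j; k; l] ->
  (forall (pi : {perm N}) S,
     (perm_dyad pi @^-1: G S = G (perm_dyad pi @^-1: S))%SET) ->
  cond_indep X [set dyad_of ij]%SET [set dyad_of kl]%SET
    (G [set dyad_of ij; dyad_of kl]%SET) ->
  cond_indep X [set dyad_of ij]%SET [set dyad_of ik]%SET
    (G [set dyad_of ij; dyad_of ik]%SET) ->
  forall u v, u != v ->
    cond_indep X [set u]%SET [set v]%SET (G [set u; v]%SET).
Proof.
move=> exch ijkl GE ind1 ind2 u v uv.
have [pi [piu piv]] := perm_dyad_pair ij ik kl ijkl uv.
suff : cond_indep X [set perm_dyad pi u]%SET [set perm_dyad pi v]%SET
    (G [set perm_dyad pi u; perm_dyad pi v]%SET).
  move=> /(@exchangeable_cond_indep pi _ _ _ exch).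
  by rewrite GE finset.preimsetU !preim_perm_dyad1.
by rewrite piu; case: piv => ->.
Qed.

(** * Faithfulness to the empty graph *)

(** Marginal independence of [A] and [B :|: C] is enough, because weak union
    moves [C] into the condition; the marginal statement is built up from
    single dyads by composition on the right and, by symmetry, on the left. *)
Lemma mutual_indep_of_pairwise : composition_property X ->
  (forall u v, u != v -> cond_indep X [set u]%SET [set v]%SET finset.set0) ->
  forall A B C, pairwise_disjoint [:: A; B; C] -> cond_indep X A B C.
Proof.
move=> comp pairs A B C; rewrite pairwise_disjoint3 => /and3P[AB AC BC].
have BCA : [disjoint B :|: C & A].
  by rewrite disjoint_setUl !(disjoint_sym _ A) AB.
(* Weak union is used with an empty initial condition. *)
rewrite -(finset.setU0 C); apply: cond_indep_weak_union => //;
  rewrite ?disjoint_set0r//.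
apply/cond_indepC/composition_of_points; rewrite ?disjoint_set0r// => a aA.
have aBC : a \notin (B :|: C)%SET.
  by apply/negP => aBC; rewrite (disjointFr BCA aBC) in aA.
apply/cond_indepC/composition_of_points; rewrite ?disjoint_set0r ?disjoints1//.
by move=> b bBC; apply: pairs; apply: contraNneq aBC => ->.
Qed.

Lemma separates_empty_graph A B C : [disjoint A & B] ->
  separates (@empty_graph (dyad N)) A B C.
Proof. by move=> AB x [|y p] //= xA xB; rewrite (disjointFr AB xA) in xB. Qed.

Lemma faithful_emptyP : faithful X (@empty_graph (dyad N)) <->
  forall A B C, pairwise_disjoint [:: A; B; C] -> cond_indep X A B C.
Proof.
have AB A B C : pairwise_disjoint [:: A; B; C] -> [disjoint A & B].
  by rewrite pairwise_disjoint3 => /and3P[].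
split=> H A B C disj; have sep := separates_empty_graph C (AB _ _ _ disj).
  by apply/H.
by split=> _ //; exact: H.
Qed.

End ConditionalIndependence.

Theorem theorem5 (R : realType) (disp : measure_display)
    (Omega : measurableType disp) (P : probability Omega R)
    (N : finType) (X : dyad N -> {RV P >-> bool})
    (i j k l : N) (ij : i != j) (ik : i != k) (il : i != l)
    (jk : j != k) (jl : j != l) (kl : k != l) :
  exchangeable X ->
  skeleton X =2 @empty_graph (dyad N) ->
  (cond_indep X [set dyad_of ij]%SET [set dyad_of kl]%SET finset.set0 /\
   cond_indep X [set dyad_of ij]%SET [set dyad_of ik]%SET finset.set0) \/
  (cond_indep X [set dyad_of ij]%SET [set dyad_of kl]%SET
     (~: [set dyad_of ij; dyad_of kl])%SET /\
   cond_indep X [set dyad_of ij]%SET [set dyad_of ik]%SET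
     (~: [set dyad_of ij; dyad_of ik])%SET) ->
  (faithful X (@empty_graph (dyad N)) <->
   intersection_property X /\ composition_property X).
Proof.
move=> exch _ cases; rewrite faithful_emptyP.
have ijkl : uniq [:: i; j; k; l].
  by rewrite /= !inE !negb_or ij ik il jk jl kl.
split=> [indep|[inter comp]].
  have union A B C D : pairwise_disjoint [:: A; B; C; D] ->
      cond_indep X A (B :|: D)%SET C.
    rewrite pairwise_disjoint4 => /and5P[AB AC AD BC /andP[BD CD]].
    apply: indep; rewrite pairwise_disjoint3 AC /=.
    by rewrite disjoint_sym !disjoint_setUl !(disjoint_sym _ A) AB AD BC
      disjoint_sym CD.
  by split=> A B C D disj _ _; exact: union.
apply: mutual_indep_of_pairwise comp _.
case: cases => -[ind1 ind2].
  apply: (exchangeable_pairs (G := fun=> finset.set0) exch ijkl _ ind1 ind2).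
  by move=> pi S; rewrite finset.preimset0.
have pairs : forall u v, u != v ->
    cond_indep X [set u]%SET [set v]%SET (~: [set u; v])%SET.
  apply: (exchangeable_pairs exch ijkl _ ind1 ind2).
  by move=> pi S; rewrite finset.preimsetC.
move=> u v uv.
(* It suffices that [u] is independent of all the other dyads jointly. *)
have uC : [disjoint [set u]%SET & (~: [set u])%SET].
  by rewrite disjoints1 !finset.inE eqxx.
apply: (@cond_indep_sub _ _ _ _ _ _ _ (~: [set u])%SET);
  rewrite ?disjoint_set0r//.
- by rewrite disjoint_sym.
- by rewrite finset.sub1set !finset.inE eq_sym.
apply: intersection_of_points; rewrite ?disjoint_set0r// => w.
rewrite !finset.inE finset.set0U => wu.
suff -> : (~: [set u] :\ w = ~: [set u; w])%SET by apply: pairs; rewrite eq_sym.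
by apply/finset.setP => z; rewrite !finset.inE negb_or andbC.
Qed.
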